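(* Let $k\ge 2$ be a fixed integer and let $n\to\infty$. Let $\beta\in(0,\tfrac12]$ be fixed, let $b=b(n)$ be integers with $b\sim\beta n$, and write $1=q\beta+r$, where $q\ge 2$ is a positive integer and $0\le r<\beta$. Put $$c_1(\beta,k)=\frac{\beta^k}{k!}\left(k-\frac{k-1}{q}\right),\qquad c_2(\beta,k)=\frac{\beta^{k-1}}{(q+1)\,k!}\bigl(k-(k-1)\beta\bigr),\qquad c_3(\beta,k)=\frac{(\beta-r)^k}{(q+1)\,k!}\,q^{k-1}.$$ a) If $r\le\frac{q-1}{q^2+q-1}$, then $B(G_{n,k,b})\sim c_1(\beta,k)\,n^k$. b) If $r>\frac{q-1}{q^2+q-1}$, then $$\max\Bigl\{c_1(\beta,k),\;c_2(\beta,k)+\frac{1}{q^{k-1}}c_3(\beta,k)\Bigr\}\,n^k\;\lesssim\; B(G_{n,k,b})\;\lesssim\;\bigl(c_2(\beta,k)+c_3(\beta,k)\bigr)\,n^k .$$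
   Context: $G_{n,k,b}$ is the graph whose vertices are the $k$-element subsets $X$ of $\{0,1,\dots,n\}$ with $\max(X)-\min(X)\le b$; two distinct vertices $X,Y$ are joined by an edge iff $\max(X\cup Y)-\min(X\cup Y)\le b$. (Here $k-1\le b\le n$.) For a finite graph $G=(V,E)$, a proper numbering is a bijection $f:V\to\{1,\dots,|V|\}$; its bandwidth is $B_f(G)=\max\{|f(u)-f(v)|:\{u,v\}\in E\}$, and the bandwidth of $G$ is $B(G)=\min_f B_f(G)$ over all proper numberings $f$. As $n\to\infty$: $g\sim h$ means $g=(1+o(1))h$, and $g\lesssim h$ means $g\le(1+o(1))h$. *)

(* Defs.v *)
From HB Require Import structures.
From mathcomp Require Import all_boot all_order all_algebra.
From mathcomp Require Import boolp classical_sets functions reals topology.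
From mathcomp Require Import normedtype sequences landau.

Set Implicit Arguments.
Unset Strict Implicit.
Unset Printing Implicit Defensive.

Import Order.TTheory GRing.Theory Num.Theory.
Import numFieldNormedType.Exports.

Local Open Scope ring_scope.

Section Bandwidth.
Variables (V : finType) (adj : rel V).

(* The codomain {0, ..., #|V|} is that of a finite function, so that one can
   minimize over numberings; the image is required to be {1, ..., #|V|}. *)
Definition proper_numbering (f : {ffun V -> 'I_#|V|.+1}) : bool :=
  injectiveb f && (f @: [set: V] == [set i : 'I_#|V|.+1 | (0 < i)%N]).

(* 0 for an edgeless graph *)
Definition numbering_bandwidth (f : {ffun V -> 'I_#|V|.+1}) : nat :=
  \max_(e : V * V | adj e.1 e.2) `|(f e.1)%:Z - (f e.2)%:Z|%N.

Lemma ex_bandwidth :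
  exists m, [exists f, proper_numbering f && (numbering_bandwidth f == m)].
Proof.
pose f := [ffun v : V => lift ord0 (enum_rank v)].
exists (numbering_bandwidth f); apply/existsP; exists f.
rewrite eqxx andbT; apply/andP; split.
  by apply/injectiveP => u v; rewrite !ffunE => /lift_inj /enum_rank_inj.
apply/eqP/setP => i; rewrite inE; apply/imsetP/idP => [[v _ ->]|].
  by rewrite ffunE lift0.
case: (unliftP ord0 i) => [j ->|->] // _.
by exists (enum_val j); rewrite ?inE // ffunE enum_valK.
Qed.

Definition bandwidth : nat := ex_minn ex_bandwidth.

End Bandwidth.

(* max X - min X for nonempty X; the neutral element n of the minimum bounds
   all elements of 'I_n.+1. *)
Definition spread (n : nat) (X : {set 'I_n.+1}) : nat :=
  (\max_(i in X) (i : nat) - \big[minn/n]_(i in X) (i : nat))%N.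

Definition G_vertex (n k b : nat) : finType :=
  {X : {set 'I_n.+1} | (#|X| == k) && (spread X <= b)%N}.

Definition G_adj (n k b : nat) : rel (G_vertex n k b) :=
  fun X Y => (X != Y) && (spread (val X :|: val Y) <= b)%N.

Lemma G_adj_sym n k b : symmetric (@G_adj n k b).
Proof. by move=> X Y; rewrite /G_adj eq_sym finset.setUC. Qed.

Lemma G_adj_irrefl n k b : irreflexive (@G_adj n k b).
Proof. by move=> X; rewrite /G_adj eqxx. Qed.

Definition bandwidth_G (n k b : nat) : nat := bandwidth (@G_adj n k b).

Local Open Scope classical_set_scope.
Local Open Scope ring_scope.

Section Constants.
Variable R : realType.
Implicit Types (beta r : R) (k q : nat).

Definition c1 beta k q : R :=
  beta ^+ k / k`!%:R * (k%:R - (k%:R - 1) / q%:R).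

Definition c2 beta k q : R :=
  beta ^+ (k - 1) / ((q%:R + 1) * k`!%:R) * (k%:R - (k%:R - 1) * beta).

Definition c3 beta k q r : R :=
  (beta - r) ^+ k / ((q%:R + 1) * k`!%:R) * q%:R ^+ (k - 1).

(* f <= (1 + o(1)) g *)
Definition asymp_le (f g : nat -> R) : Prop :=
  exists2 e : nat -> R, e @ \oo --> (0 : R) &
    \forall n \near \oo, f n <= (1 + e n) * g n.

(* The library's f ~_\oo g is f = g + o(g); this is f = (1 + o(1)) g. *)
Lemma asymp_eqP (f g : nat -> R) :
  f ~_\oo g <->
  exists2 e : nat -> R, e @ \oo --> (0 : R) &
    \forall n \near \oo, f n = (1 + e n) * g n.
Proof.
split=> [/eqaddoP fg|[e e0 fe]].
- exists (fun n => (f n - g n) / g n).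
  + apply/cvgr0Pnorm_le => eps eps0; near=> n.
    have : `|(f - g) n| <= eps * `|g n| by near: n; exact: fg.
    rewrite !fctE /= => h; rewrite normrM normfV.
    have [->|gn0] := eqVneq (g n) 0; first by rewrite normr0 invr0 mulr0 ltW.
    by rewrite ler_pdivrMr ?normr_gt0.
  + near=> n.
    have : `|(f - g) n| <= 1 * `|g n| by near: n; exact: (fg _ ltr01).
    rewrite !fctE /= mul1r.
    have [->|gn0 _] := eqVneq (g n) 0.
      by rewrite normr0 normr_le0 subr0 mulr0 => /eqP.
    by rewrite mulrDl mul1r divfK // addrC subrK.
- apply/eqaddoP => eps eps0; near=> n.
  rewrite fctE /=.
  have -> : f n = (1 + e n) * g n by near: n.
  rewrite mulrDl mul1r addrAC subrr add0r normrM ler_wpM2r //.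
  by near: n; move/cvgr0Pnorm_le: e0; apply.
Unshelve. all: by end_near. Qed.

End Constants.

(* Main.v *)
Require Import Defs.
From HB Require Import structures.
From mathcomp Require Import all_boot all_order all_algebra.
From mathcomp Require Import zify ring lra.
From mathcomp Require Import boolp classical_sets functions reals topology.
From mathcomp Require Import normedtype sequences landau.
From mathcomp Require Import fintype finset.

Set Implicit Arguments.
Unset Strict Implicit.
Unset Printing Implicit Defensive.

Import Order.TTheory GRing.Theory Num.Theory.
Import numFieldNormedType.Exports.

(** The key is to read a numbering of small bandwidth as a schedule.  Put
    T = b + 1, the number of points in a window of diameter b.  Let H be a
    nondecreasing function of the position and ask for a numbering f with
      H (min X) <= f X < H (max X + 1)    for every vertex X.
    Adjacent vertices lie in a common window [t, t + b], so their numbers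
    differ by less than H (t + T) - H t.  Every vertex is thus a unit job with
    a release time and a deadline, and scheduling the released job of earliest
    deadline first succeeds as soon as every interval offers enough room
    ([interval_scheduling]): H y - H x must be at least the number of vertices
    inside [x, y).  Hence the bandwidth is at most the largest growth of such
    an H over one period T ([bandwidth_le_profile]).

    The number of vertices inside an interval of l * T points is about
    T^k / k! * w l, where w l = l^k for l <= 1 and w continues along its tangent
    line, w l = 1 + k (l - 1), for l >= 1.  Up to this factor H is taken
    piecewise linear with periodic slope: in each period a steep dense stretch
    is followed by a flatter sparse stretch of length s / q, where s <= 1.  The
    slope on the sparse stretch is s^(k-1), and the slope on the dense stretch
    is the one for which q + 1 dense and q sparse stretches have exactly the
    mass required by w for an interval of their total length.  The room
    condition then splits into three cases: intervals shorter than a period,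
    by convexity of the power ([room_short]); intervals of at most q periods,
    by Bernoulli's inequality ([room_long]); and longer ones, by the choice of
    the dense slope ([room_total]).  The growth per period is
      (1 + k q - k s / q + s^k / q) / (q + 1),
    and rounding H to integers costs at most 1 ([bandwidth_upper]).  The sparse
    stretch may be as long as the overlap (q + 1) T - (n + 1) of q + 1 windows
    that cover [0, n], but s <= 1.  So s tends to min (1, q (beta - r) / beta).  The threshold on r
    says which term is smaller: s = 1 gives c1, the other value gives c2 + c3.

    Both lower bounds count along paths.  Two vertices in an interval of about
    j b points are joined by a path of j edges through blocks of k consecutive
    points, so their numbers differ by at most j times the bandwidth
    ([close_of_reach]).  Applied to all vertices inside an interval of about
    q b points, this gives c1.  For the other bound let U and W have the first
    and the last number.  Any two vertices are joined by q + 1 edges, and there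
    is an interval of about (beta - r) n points each of whose k-subsets is
    within 1 of one of U and W and within q of the other.  With N vertices and
    bandwidth B, the numbers of all these k-subsets lie in an interval of about
    (q + 1) B - N values ([card_overlap_le_bandwidth]). *)

(** * Scheduling unit jobs *)

(** Hall's theorem for intervals of slots, by the rule that the earliest
    deadline goes first.  Among the jobs of smallest release time [a], the job
    [j] of earliest deadline gets slot [a], and the others are released at
    [a + 1] at the earliest.  Room is preserved: if the delay adds a job to
    those confined to [a + 1, d), that job has release time [a], so [hi j <= d]
    and [j] was counted in the room of [a, d). *)
Lemma interval_scheduling (V : finType) (A : {set V}) (lo hi : V -> nat) :
  (forall a b, #|[set v in A | (a <= lo v) && (hi v <= b)]| <= b - a) ->
  exists2 f : V -> nat, {in A &, injective f} &
    {in A, forall v, lo v <= f v < hi v}.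
Proof.
have [m] := ubnP #|A|; elim: m => // m IHm in A lo *.
rewrite ltnS => leAm hall.
have [->|/set0Pn[v0 v0A]] := eqVneq A set0.
  by exists lo => [u v|v]; rewrite inE.
pose a := lo [arg min_(v < v0 in A) lo v].
have [w0 w0A w0a] : exists2 w, w \in A & lo w = a.
  by rewrite /a; case: arg_minnP => // w wA _; exists w.
have a_min v : v \in A -> a <= lo v.
  by rewrite /a; case: arg_minnP => // w wA; apply.
pose j := [arg min_(v < w0 | (v \in A) && (lo v == a)) hi v].
have [jA ja j_min] : [/\ j \in A, lo j = a &
    forall v, v \in A -> lo v = a -> hi j <= hi v].
  rewrite /j; case: arg_minnP => [|w /andP[wA /eqP wa] wmin].
    by rewrite w0A w0a eqxx.
  by split=> // v vA va; apply: wmin; rewrite vA va eqxx.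
have ltj : a < hi j.
  have := hall a (hi j); rewrite -subn_gt0; apply: leq_trans.
  by apply/card_gt0P; exists j; rewrite inE jA ja !leqnn.
have [||f f_inj f_in] := IHm (A :\ j) (fun v => maxn (lo v) a.+1).
- by move: leAm; rewrite (cardsD1 j) jA.
- move=> c d; case: (leqP c a.+1) => [ca|ac]; last first.
    apply: leq_trans (hall c d); apply/subset_leq_card/subsetP => v.
    rewrite !inE => /andP[/andP[_ ->]] /=; lia.
  (* The delay adds a job to the interval only if [hi j <= d]. *)
  have [jd|dj] := leqP (hi j) d.
    have := hall a d; rewrite (cardsD1 j) inE jA ja leqnn jd /= => le1.
    apply: (@leq_trans (d - a).-1); last by lia.
    apply: (@leq_trans #|[set v in A | (a <= lo v) && (hi v <= d)] :\ j|);
      last by lia.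
    apply/subset_leq_card/subsetP => v; rewrite !inE => /andP[/andP[-> vA]] /=.
    by rewrite vA a_min //= => /andP[].
  apply: leq_trans (leq_trans (hall a.+1 d) _); last by lia.
  apply/subset_leq_card/subsetP => v; rewrite !inE.
  move=> /andP[/andP[_ vA]] /andP[_ vd]; rewrite vA vd andbT /=.
  rewrite ltn_neqAle a_min // andbT; apply/eqP => av.
  by have := j_min v vA (esym av); lia.
exists (fun v => if v == j then a else f v) => [u v uA vA|v vA] /=.
  have gta w : w \in A -> w != j -> a < f w.
    move=> wA wj; have := f_in w; rewrite !inE wj wA => /(_ isT); lia.
  case: eqVneq => [->|uj]; case: eqVneq => [->|vj] //.
  - by have := gta v vA vj; lia.
  - by have := gta u uA uj; lia.
  - by apply: f_inj; rewrite !inE ?uj ?vj.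
case: eqVneq => [->|vj]; first by rewrite ja leqnn ltj.
by have := f_in v; rewrite !inE vj vA => /(_ isT); lia.
Qed.

(** * Numberings and bandwidth *)
Section Numberings.
Variables (V : finType) (adj : rel V).
Implicit Types (f : V -> nat) (u v w : V) (m : nat).

Lemma card_le_interval f (A : {set V}) a m : injective f ->
  {in A, forall v, a <= f v < a + m} -> #|A| <= m.
Proof.
move=> f_inj f_in; case: m f_in => [f_in|m f_in].
  rewrite leqn0 cards_eq0 -subset0; apply/subsetP => v /f_in; lia.
rewrite -(card_in_imset (f := fun v => inord (f v - a) : 'I_m.+1)).
  by rewrite -[leqRHS]card_ord max_card.
move=> u v /f_in uA /f_in vA /(congr1 val) /=.
by rewrite !inordK; [|lia..] => e; apply: f_inj; lia.
Qed.

Lemma rank_gap f u v : injective f -> f u <= f v ->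
  #|[set w | f w <= f v]| - #|[set w | f w <= f u]| <= f v - f u.
Proof.
move=> f_inj uv.
have sub : [set w | f w <= f u] \subset [set w | f w <= f v].
  by apply/subsetP => w; rewrite !inE => /leq_trans; apply.
rewrite -cardsDS //; apply: (@card_le_interval f _ (f u).+1) => // w.
by rewrite !inE -ltnNge => /andP[uw wv]; lia.
Qed.

(** Gaps in an injective labelling are harmless: replacing each label by its
    rank gives a proper numbering and does not increase any difference. *)
Lemma bandwidth_le f m : injective f ->
  (forall u v, adj u v -> f u - f v <= m /\ f v - f u <= m) ->
  bandwidth adj <= m.
Proof.
move=> f_inj f_adj.
pose rk v := #|[set w | f w <= f v]|.
have rk_lt v : rk v < #|V|.+1 by rewrite ltnS max_card.
have rk_gt0 v : 0 < rk v by apply/card_gt0P; exists v; rewrite inE.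
have rk_mono u v : f u < f v -> rk u < rk v.
  move=> uv; apply/proper_card/properP; split.
    by apply/subsetP => w; rewrite !inE => /leq_trans; apply; apply: ltnW.
  by exists v; rewrite !inE // -ltnNge.
have rk_inj : injective rk.
  move=> u v e; apply: f_inj; case: (ltngtP (f u) (f v)) => // /rk_mono.
    by rewrite e ltnn.
  by rewrite e ltnn.
pose g := [ffun v => Ordinal (rk_lt v)].
have g_inj : injective g by move=> u v; rewrite !ffunE => -[/rk_inj].
have g_num : proper_numbering g.
  apply/andP; split; first exact/injectiveP.
  rewrite eqEcard card_imset // cardsT; apply/andP; split.
    by apply/subsetP => _ /imsetP[v _ ->]; rewrite inE ffunE rk_gt0.
  have le : #|[set~ (ord0 : 'I_#|V|.+1)]| <= #|V| by rewrite cardsC1 card_ord.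
  apply: leq_trans le; apply/subset_leq_card/subsetP => i.
  by rewrite !inE; case: eqVneq => // ->.
rewrite /bandwidth; case: ex_minnP => b _ b_min.
apply: leq_trans (b_min (numbering_bandwidth adj g) _) _.
  by apply/existsP; exists g; rewrite g_num eqxx.
apply/bigmax_leqP => -[u v] /= /f_adj[uv vu]; rewrite !ffunE /=.
case: (leqP (f u) (f v)) => [le|/ltnW le].
  by have := rank_gap f_inj le; rewrite -/(rk u) -/(rk v);
    case: (ltngtP (f u) (f v)) le => // [/rk_mono|/f_inj ->]; lia.
by have := rank_gap f_inj le; rewrite -/(rk u) -/(rk v);
  case: (ltngtP (f v) (f u)) le => // [/rk_mono|/f_inj ->]; lia.
Qed.

Lemma bandwidth_witness :
  exists2 f : V -> nat, [/\ injective f, forall v, 0 < f v <= #|V| &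
      forall i, 0 < i <= #|V| -> exists v, f v = i] &
    forall u v, adj u v ->
      f u <= f v + bandwidth adj /\ f v <= f u + bandwidth adj.
Proof.
rewrite /bandwidth; case: ex_minnP => b /existsP[g /andP[g_num /eqP g_b]] _.
have /andP[/injectiveP g_inj /eqP g_im] := g_num.
exists (fun v => val (g v)); first split.
- by move=> u v /val_inj /g_inj.
- move=> v; have : g v \in g @: [set: V] by rewrite imset_f.
  by rewrite g_im inE => ->; rewrite -ltnS ltn_ord.
- move=> i /andP[i0 iV]; have iV' : i < #|V|.+1 by [].
  have : Ordinal iV' \in g @: [set: V] by rewrite g_im inE.
  by move=> /imsetP[v _ /(congr1 val)]; exists v.
- move=> u v uv; suff: absz (Posz (g u) - Posz (g v))%R <= b.
    by move=> /=; move: (g u : nat) (g v : nat) => x y; lia.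
  rewrite -g_b /numbering_bandwidth.
  exact: (@leq_bigmax_cond _ (fun e : V * V => adj e.1 e.2)
    (fun e => absz (Posz (g e.1) - Posz (g e.2))%R) (u, v)).
Qed.

Lemma card_le_of_close f (A : {set V}) m : injective f ->
  {in A &, forall u v, f u <= f v + m} -> #|A| <= m.+1.
Proof.
move=> f_inj close.
have [->|/set0Pn[v0 v0A]] := eqVneq A set0; first by rewrite cards0.
have [w wA w_min] : exists2 w, w \in A & forall v, v \in A -> f w <= f v.
  by case: (arg_minnP f v0A) => w; exists w.
apply: (@card_le_interval f _ (f w)) => // v vA.
by have := (close _ _ vA wA, w_min _ vA) => -[]; lia.
Qed.

End Numberings.

(** * The vertices of the graph *)
Section Extremes.
Variable n : nat.
Implicit Types (X Y : {set 'I_n.+1}) (i : 'I_n.+1).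

Definition set_max X : nat := \max_(i in X) (i : nat).
Definition set_min X : nat := \big[minn/n]_(i in X) (i : nat).

Lemma spreadE X : spread X = set_max X - set_min X.
Proof. by []. Qed.

Lemma set_max_ge X i : i \in X -> i <= set_max X.
Proof. exact: leq_bigmax_cond. Qed.

Lemma set_min_le X i : i \in X -> set_min X <= i.
Proof.
move=> iX; rewrite /set_min -minEnat.
exact: (@bigmin_le_cond _ _ _ n i (mem X) (fun i => i : nat) iX).
Qed.

Lemma set_max_mem X : X != set0 -> exists2 i, i \in X & set_max X = i.
Proof.
rewrite -card_gt0 => /(@eq_bigmax_cond _ (mem X) (fun i => i : nat))[i iX e].
by exists i.
Qed.

Lemma set_min_mem X : X != set0 -> exists2 i, i \in X & set_min X = i.
Proof.
case/set0Pn => i0 i0X.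
have [w wX w_min] : exists2 w, w \in X & forall v, v \in X -> (w : nat) <= v.
  by case: (arg_minnP (fun i => i : nat) i0X) => w; exists w.
exists w => //; apply/eqP; rewrite eqn_leq set_min_le //= /set_min.
elim/big_ind: _ => [|a c wa wc|i /w_min] //; first by rewrite -ltnS ltn_ord.
by rewrite leq_min wa.
Qed.

Lemma set_min_ge X a : X != set0 ->
  (a <= set_min X) = [forall i in X, a <= (i : nat)].
Proof.
move=> X0; apply/idP/forall_inP => [le i /set_min_le|le].
  exact: leq_trans.
by have [i iX ->] := set_min_mem X0; apply: le.
Qed.

Lemma set_max_lt X a : X != set0 ->
  (set_max X < a) = [forall i in X, (i : nat) < a].
Proof.
move=> X0; apply/idP/forall_inP => [lt i /set_max_ge le|lt].
  exact: leq_ltn_trans lt.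
by have [i iX ->] := set_max_mem X0; apply: lt.
Qed.

Lemma set_min_le_max X : X != set0 -> set_min X <= set_max X.
Proof. by case/set0Pn => i iX; rewrite (leq_trans (set_min_le iX)) ?set_max_ge. Qed.

End Extremes.

Section Vertices.
Variables (n k b : nat).
Hypothesis k_gt0 : 0 < k.
Local Notation V := (G_vertex n k b).
Implicit Types (u v w : V) (x y z : nat).

Definition vmin v := set_min (val v).
Definition vmax v := set_max (val v).

Lemma card_vertex v : #|val v| = k.
Proof. by have /andP[/eqP] := valP v. Qed.

Lemma vertex_neq0 v : val v != set0.
Proof. by rewrite -card_gt0 card_vertex. Qed.

Lemma vmin_le_max v : vmin v <= vmax v.
Proof. exact/set_min_le_max/vertex_neq0. Qed.

Lemma vmax_le v : vmax v <= n.
Proof. by rewrite -ltnS set_max_lt ?vertex_neq0 //; apply/forall_inP. Qed.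

Lemma vmax_le_min v : vmax v <= vmin v + b.
Proof. by have /andP[_] := valP v; rewrite spreadE leq_subLR addnC. Qed.

Lemma adj_extremes u v : G_adj u v ->
  vmax u <= vmin v + b /\ vmax v <= vmin u + b.
Proof.
case/andP=> _; rewrite spreadE => le.
have U0 : val u :|: val v != set0.
  by case/set0Pn: (vertex_neq0 u) => i iu; apply/set0Pn; exists i; rewrite inE iu.
have gap i j : i \in val u :|: val v -> j \in val u :|: val v -> i <= j + b.
  move=> /set_max_ge le_i /set_min_le le_j.
  by lia.
have [i iu ei] := set_max_mem (vertex_neq0 u).
have [j jv ej] := set_max_mem (vertex_neq0 v).
have [i' iu' ei'] := set_min_mem (vertex_neq0 u).
have [j' jv' ej'] := set_min_mem (vertex_neq0 v).
by rewrite /vmax /vmin ei ei' ej ej' !gap // inE ?iu ?jv ?iu' ?jv' ?orbT.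
Qed.

Lemma extremes_adj u v : u != v ->
  vmax u <= vmin v + b -> vmax v <= vmin u + b -> G_adj u v.
Proof.
move=> uv le1 le2; rewrite /G_adj uv /= spreadE.
have U0 : val u :|: val v != set0.
  by case/set0Pn: (vertex_neq0 u) => i iu; apply/set0Pn; exists i; rewrite inE iu.
have [i iU ei] := set_max_mem U0; have [j jU ej] := set_min_mem U0.
rewrite ei ej.
have lu := vmax_le_min u; have lv := vmax_le_min v.
have ge (z : 'I_n.+1) w : z \in val w -> vmin w <= z <= vmax w.
  by move=> zw; rewrite set_min_le ?set_max_ge.
by move: iU jU; rewrite !inE => /orP[] /ge /andP[? ?] /orP[] /ge /andP[? ?]; lia.
Qed.

Lemma card_ord_interval x y : y <= n.+1 ->
  #|[set i : 'I_n.+1 | x <= i < y]| = y - x.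
Proof.
move=> yn; elim: y yn => [_|y IHy yn].
  by apply: eq_card0 => i; rewrite inE andbF.
have [xy|yx] := leqP x y; last first.
  transitivity 0; last by lia.
  by apply: eq_card0 => i; rewrite inE; apply/negbTE; lia.
rewrite (cardsD1 (Ordinal yn)) inE /= xy ltnSn subSn // add1n; congr _.+1.
rewrite -IHy ?(ltnW yn) //; apply: eq_card => i; rewrite !inE -val_eqE /=; lia.
Qed.

(** Blocks of [k] consecutive points are the intermediate vertices of the
    shortest paths. *)
Lemma exists_block z : k <= b.+1 -> z + k <= n.+1 ->
  exists v, vmin v = z /\ vmax v = (z + k).-1.
Proof.
move=> kb zn; pose X := [set i : 'I_n.+1 | z <= i < z + k].
have Xk : #|X| = k by rewrite card_ord_interval // addKn.
have X0 : X != set0 by rewrite -card_gt0 Xk.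
have inX i (lt : i < n.+1) : z <= i < z + k -> Ordinal lt \in X by rewrite inE.
have zn1 : z < n.+1 by lia.
have zn2 : (z + k).-1 < n.+1 by lia.
have eX : set_min X = z.
  apply/eqP; rewrite eqn_leq set_min_ge //; apply/andP; split.
    by apply: (@set_min_le _ _ (Ordinal zn1)); apply: inX; lia.
  by apply/forall_inP => i; rewrite inE => /andP[].
have eX' : set_max X = (z + k).-1.
  apply/eqP; rewrite eqn_leq -ltnS set_max_lt //; apply/andP; split.
    by apply/forall_inP => i; rewrite inE; lia.
  by apply: (@set_max_ge _ _ (Ordinal zn2)); apply: inX; lia.
have Xb : (#|X| == k) && (spread X <= b).
  by rewrite Xk eqxx /= spreadE eX eX'; lia.
by exists (Sub X Xb); rewrite /vmin /vmax SubK.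
Qed.

Definition inside x y : {set V} := [set v | (x <= vmin v) && (vmax v < y)].

Lemma card_inside_short x y : y <= n.+1 -> y <= x + b.+1 ->
  #|inside x y| = 'C(y - x, k).
Proof.
move=> yn yx; rewrite -(card_ord_interval x yn) -cards_draws.
rewrite -(card_imset _ val_inj); apply: eq_card => X; rewrite inE.
apply/imsetP/andP => [[v]|[XI /eqP Xk]].
  rewrite inE => /andP[xv vy] ->; rewrite card_vertex eqxx; split=> //.
  apply/subsetP => i iv; rewrite inE.
  by rewrite (leq_trans xv) ?set_min_le // (leq_ltn_trans _ vy) ?set_max_ge.
have X0 : X != set0 by rewrite -card_gt0 Xk.
have XI' i : i \in X -> x <= i < y by move=> /(subsetP XI); rewrite inE.
have lb : x <= set_min X.
  by rewrite set_min_ge //; apply/forall_inP => i /XI' /andP[].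
have ub : set_max X < y.
  by rewrite set_max_lt //; apply/forall_inP => i /XI' /andP[].
have Xb : (#|X| == k) && (spread X <= b).
  rewrite Xk eqxx /= spreadE; lia.
by exists (Sub X Xb); rewrite ?SubK // inE /vmin /vmax SubK lb.
Qed.

(** The new vertices are those of maximum [y].  Their number does not depend
    on the left end, because their spread confines them to [y - b, y]; on that
    window it is a difference of two binomial coefficients. *)
Lemma card_inside_step x y : y <= n -> x + b <= y ->
  #|inside x y.+1| = #|inside x y| + 'C(b, k.-1).
Proof.
move=> yn xy.
have split_max z : z + b <= y ->
    #|inside z y.+1| = #|inside z y| + #|[set v | vmax v == y]|.
  move=> zy; rewrite -[in LHS](cardsID (inside z y)); congr (_ + _).
    by apply: eq_card => v; rewrite !inE; lia.
  by apply: eq_card => v; rewrite !inE; have := vmax_le_min v; lia.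
rewrite (split_max x xy); congr (_ + _).
have e : y - (y - b) = b by lia.
have := split_max (y - b); rewrite !card_inside_short; [|lia..].
rewrite subSn ?leq_subr // e subnK; last by lia.
have -> : 'C(b.+1, k) = 'C(b, k) + 'C(b, k.-1).
  by rewrite -[in LHS](prednK k_gt0) binS prednK.
by move=> /(_ (leqnn _)); lia.
Qed.

Lemma card_inside_long x m : x + b.+1 + m <= n.+1 ->
  #|inside x (x + b.+1 + m)| = 'C(b.+1, k) + m * 'C(b, k.-1).
Proof.
elim: m => [|m IHm] le.
  rewrite addn0 mul0n card_inside_short; [|lia..].
  by rewrite addn0 addKn.
by rewrite addnS card_inside_step; [rewrite IHm; [rewrite mulSn; lia|lia]|lia..].
Qed.

Lemma card_G_vertex : #|V| = #|inside 0 n.+1|.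
Proof.
by rewrite -cardsT; apply: eq_card => v; rewrite !inE /= ltnS vmax_le.
Qed.

End Vertices.

(** * Bounds on the bandwidth for fixed n *)
Section GraphBounds.
Variables (n k b : nat).
Hypothesis k_gt0 : 0 < k.
Local Notation V := (G_vertex n k b).
Local Notation B := (bandwidth_G n k b).

(** A profile [H] turns the vertices into jobs to be run in the slots
    [H (min X), ..., H (max X + 1) - 1].  The jobs confined to slots [a, c) all
    lie between the smallest minimum and the largest maximum among them, so
    the room condition is only needed for intervals of positions. *)
Lemma bandwidth_le_profile (H : nat -> nat) m :
  {homo H : x y / x <= y} ->
  (forall x y, x < y <= n.+1 -> #|inside n k b x y : {set V}| <= H y - H x) ->
  (forall t, H (t + b.+1) <= H t + m) ->
  B <= m.
Proof.
move=> H_mono H_room H_window.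
have [|f f_inj f_in] := @interval_scheduling V setT
  (fun v => H (vmin v)) (fun v => H (vmax v).+1).
  move=> a c; set D := [set v in _ | _].
  have [->|/set0Pn[v0 v0D]] := eqVneq D set0; first by rewrite cards0.
  have [u uD u_min] : exists2 u, u \in D & forall v, v \in D -> vmin u <= vmin v.
    by case: (arg_minnP (fun v : V => vmin v) v0D) => u; exists u.
  have [w wD w_max] : exists2 w, w \in D & forall v, v \in D -> vmax v <= vmax w.
    by case: (arg_maxnP (fun v : V => vmax v) v0D) => w; exists w.
  have uw : vmin u < (vmax w).+1 <= n.+1.
    by rewrite !ltnS vmax_le // andbT (leq_trans _ (w_max _ uD)) // vmin_le_max.
  apply: leq_trans (leq_trans (H_room _ _ uw) _).
    apply/subset_leq_card/subsetP => v vD.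
    by rewrite inE u_min // ltnS w_max.
  by move: uD wD; rewrite !inE /=; lia.
apply: (@bandwidth_le _ _ f) => [u v|u v /(adj_extremes k_gt0)[uv vu]].
  by apply: f_inj; rewrite inE.
have /andP[fu fu'] := f_in u (in_setT _); have /andP[fv fv'] := f_in v (in_setT _).
have uu := vmax_le_min u; have vv := vmax_le_min v.
have [le|/ltnW le] := leqP (vmin u) (vmin v).
  have := H_window (vmin u); have := H_mono _ _ le.
  have [] : H (vmax u).+1 <= H (vmin u + b.+1) /\
            H (vmax v).+1 <= H (vmin u + b.+1) by split; apply: H_mono; lia.
  by lia.
have := H_window (vmin v); have := H_mono _ _ le.
have [] : H (vmax u).+1 <= H (vmin v + b.+1) /\
          H (vmax v).+1 <= H (vmin v + b.+1) by split; apply: H_mono; lia.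
by lia.
Qed.

Hypothesis kb : k <= b.+1.

Section Reach.
Variables (f : V -> nat).
Hypothesis f_adj : forall u v, G_adj u v -> f u <= f v + B /\ f v <= f u + B.

Lemma close_of_window (u v : V) :
  vmax u <= vmin v + b -> vmax v <= vmin u + b ->
  f u <= f v + B /\ f v <= f u + B.
Proof.
have [->|uv] := eqVneq u v; first by rewrite !leq_addr.
by move=> le1 le2; apply/f_adj/extremes_adj.
Qed.

(** Each step of the path moves a block of [k] points by [b + 1 - k], the most
    an edge allows.  If the block overshoots the minimum of [v], it is already
    adjacent to [v]. *)
Lemma close_of_reach j (u v : V) : 0 < j ->
  vmin u <= vmin v -> vmax v < vmin u + j * (b.+1 - k) + k ->
  f u <= f v + j * B /\ f v <= f u + j * B.
Proof.
case: j => // j _; elim: j u => [|j IHj] u uv reach.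
  rewrite mul1n; apply: close_of_window; last by lia.
  by have := vmax_le_min u; lia.
have [near|far] := leqP (vmax v) (vmin u + b).
  have [] := @close_of_window u v _ near; first by have := vmax_le_min u; lia.
  by rewrite mulSn; lia.
have vn := vmax_le k_gt0 v.
have [|z [z_min z_max]] := @exists_block n k b k_gt0 (vmin u + (b.+1 - k)) kb.
  by lia.
have [uz zu] : f u <= f z + B /\ f z <= f u + B.
  by apply: close_of_window; have := vmax_le_min u; lia.
have [zv|vz] := leqP (vmin z) (vmin v).
  have [] := IHj z zv; first by rewrite z_min; move: reach; rewrite mulSn; lia.
  by rewrite [j.+2 * B]mulSn; lia.
have [] := @close_of_window z v; first by lia.
  by have := vmax_le_min v; lia.
by rewrite !mulSn; lia.
Qed.

End Reach.

Lemma card_le_bandwidth j y : 0 < j -> y <= j * (b.+1 - k) + k ->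
  #|inside n k b 0 y : {set V}| <= (j * B).+1.
Proof.
move=> j0 yj; have [f [f_inj _ _] f_adj] := bandwidth_witness (@G_adj n k b).
apply: (card_le_of_close f_inj) => u v; rewrite !inE /= => uy vy.
have [uv|/ltnW vu] := leqP (vmin u) (vmin v).
  by have [] := close_of_reach f_adj j0 uv; first by lia.
by have [] := close_of_reach f_adj j0 vu; first by lia.
Qed.

(** Here [r] is the number of points of [0, n] not covered by a path of [q]
    edges.  Let [u1] start no later than [u2], the vertices numbered first and
    last in some order.  A [k]-subset of the last [b + 1 - r] points of a window
    starting at [min u1] is adjacent to [u1] and reaches [u2] in [q] edges.
    Its number is then confined to an interval of [(q + 1) B - |V| + 2] values.
    Near the right end of [0, n] the window is moved back to start at
    [n - b]. *)
Lemma card_overlap_le_bandwidth q : 0 < q -> b <= n ->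
  let r := n.+1 - (q * (b.+1 - k) + k) in
  r + k <= b.+1 -> #|V| + 'C(b.+1 - r, k) <= q.+1 * B + 2.
Proof.
move=> q0 bn r rb.
have [f [f_inj f_le f_onto] f_adj] := bandwidth_witness (@G_adj n k b).
have V0 : 0 < #|V|.
  have [|v _] := @exists_block n k b k_gt0 0 kb; first by lia.
  by apply/card_gt0P; exists v.
have [u fu] : exists u, f u = 1 by apply: f_onto; rewrite V0.
have [w fw] : exists w, f w = #|V| by apply: f_onto; rewrite V0 leqnn.
have key (u1 u2 : V) : vmin u1 <= vmin u2 ->
    exists2 A : {set V}, #|A| = 'C(b.+1 - r, k) & {in A, forall z,
      [/\ f z <= f u1 + B, f u1 <= f z + B,
          f z <= f u2 + q * B & f u2 <= f z + q * B]}.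
  move=> le12; pose t := minn (vmin u1) (n - b).
  exists (inside n k b (t + r) (t + b.+1)).
    rewrite card_inside_short //; [|lia..].
    by congr 'C(_, _); lia.
  have u1n := vmax_le k_gt0 u1.
  have u2n := vmax_le k_gt0 u2.
  have u1b := vmax_le_min u1; have u2b := vmax_le_min u2.
  have u1m := vmin_le_max k_gt0 u1; have u2m := vmin_le_max k_gt0 u2.
  move=> z; rewrite inE => /andP[z1 z2].
  have zn := vmax_le k_gt0 z; have zb := vmax_le_min z.
  have zm := vmin_le_max k_gt0 z.
  have [zu uz] : f z <= f u1 + B /\ f u1 <= f z + B.
    by apply: (close_of_window f_adj); lia.
  suff [] : f z <= f u2 + q * B /\ f u2 <= f z + q * B by split.
  have [zu2|u2z] := leqP (vmin z) (vmin u2).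
    by apply: close_of_reach => //; lia.
  have [] : f z <= f u2 + B /\ f u2 <= f z + B.
    by apply: (close_of_window f_adj); lia.
  have : B <= q * B by rewrite leq_pmull.
  lia.
have M0 : 0 < 'C(b.+1 - r, k) by rewrite bin_gt0; lia.
have [uw|/ltnW wu] := leqP (vmin u) (vmin w); [have [A cA inA] := key _ _ uw|
  have [A cA inA] := key _ _ wu].
- suff : #|A| <= q.+1 * B + 2 - #|V| by lia.
  apply: (@card_le_interval _ f _ (#|V| - q * B)) => // z zA.
  by have [] := inA z zA; have := f_le z; rewrite mulSn; lia.
- suff : #|A| <= q.+1 * B + 2 - #|V| by lia.
  apply: (@card_le_interval _ f _ (#|V| - B)) => // z zA.
  by have [] := inA z zA; have := f_le z; rewrite mulSn; lia.
Qed.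

End GraphBounds.

(** * The periodic profile

    Lengths are measured in periods.  A period consists of a dense stretch of
    length [1 - s / Q] and a sparse stretch of length [s / Q]; [m] denotes the
    length covered by sparse stretches inside an interval of length [l]. *)
Section Profile.
Local Open Scope ring_scope.
Variable R : realFieldType.
Implicit Types (x y s l m j : R) (k q : nat).

Lemma bernoulli_le x k : 0 <= x -> k%:R * (x - 1) <= x ^+ k - 1.
Proof.
move=> x0; elim: k => [|k IHk]; first by rewrite mul0r expr0 subrr.
have : 0 <= k%:R * (x - 1) ^+ 2 by rewrite mulr_ge0 ?sqr_ge0.
have := ler_wpM2l x0 IHk; rewrite expr2 exprS -natr1; lra.
Qed.

Lemma pow_chord x y l k : 0 <= x <= l -> l <= y ->
  (y - x) * l ^+ k <= (y - l) * x ^+ k + (l - x) * y ^+ k.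
Proof.
move=> /andP[x0 xl] ly; elim: k => [|k IHk].
  by rewrite !expr0; lra.
have l0 : 0 <= l by lra.
have : 0 <= (y - l) * (l - x) * (y ^+ k - x ^+ k).
  by rewrite !mulr_ge0 ?subr_ge0 // lerXn2r ?nnegrE; lra.
have := ler_wpM2l l0 IHk; rewrite !exprS; lra.
Qed.

Variables (k q : nat) (s : R).
Hypotheses (k_gt0 : (0 < k)%N) (q_gt1 : (1 < q)%N) (s01 : 0 <= s <= 1).
Local Notation K := (k%:R : R).
Local Notation Q := (q%:R : R).

(** The mass of one dense stretch, chosen such that [Q + 1] dense and [Q] sparse
    stretches, of total length [Q + 1 - s / Q], have mass
    [1 + K * (Q - s / Q)]. *)
Definition dense_mass : R := (1 + K * Q - K * s / Q - s ^+ k) / (Q + 1).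
Definition dense_slope : R := dense_mass / (1 - s / Q).
Definition sparse_slope : R := s ^+ k.-1.
Definition period_mass : R := dense_mass + s ^+ k / Q.

Let param_bounds : [/\ 0 <= s, s <= 1, 1 <= K, 2 <= Q & 0 < Q].
Proof.
have [s0 s1] := andP s01; have Q2 : 2 <= Q by rewrite ler_nat.
by split=> //; [rewrite ler1n|lra].
Qed.

Let sQ_bounds : [/\ 0 <= s / Q, s / Q <= 1 / 2, s / Q <= s & s / Q * Q = s].
Proof.
have [s0 s1 K1 Q2 Q0] := param_bounds.
by split; [rewrite divr_ge0 //; lra|rewrite ler_pdivrMr //; lra
  |rewrite ler_pdivrMr //; nra|rewrite divfK //; lra].
Qed.

Let sk_bounds : [/\ 0 <= s ^+ k, s ^+ k <= 1, s ^+ k <= s &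
  K * (s - 1) <= s ^+ k - 1].
Proof.
have [s0 s1 K1 Q2 Q0] := param_bounds.
split; [exact: exprn_ge0|exact: exprn_ile1| |exact: bernoulli_le].
by rewrite -(prednK k_gt0) exprS ler_piMr // exprn_ile1.
Qed.

Lemma dense_massE : dense_slope * (1 - s / Q) = dense_mass.
Proof.
have [s0 s1 K1 Q2 Q0] := param_bounds.
have [sQ0 sQ2 sQs sQQ] := sQ_bounds.
have [sk0 sk1 sks bern] := sk_bounds.
by rewrite /dense_slope divfK //; lra.
Qed.

Lemma sparse_massE : sparse_slope * (s / Q) = s ^+ k / Q.
Proof.
have [s0 s1 K1 Q2 Q0] := param_bounds.
have [sQ0 sQ2 sQs sQQ] := sQ_bounds.
have [sk0 sk1 sks bern] := sk_bounds.
by rewrite /sparse_slope mulrA -exprSr prednK.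
Qed.

Lemma sparse_slope_ge0 : 0 <= sparse_slope.
Proof. by have [s0 _ _ _ _] := param_bounds; apply: exprn_ge0. Qed.

Lemma sparse_slope_le1 : sparse_slope <= 1.
Proof. by have [s0 s1 _ _ _] := param_bounds; apply: exprn_ile1. Qed.

Let massM : dense_mass * (Q + 1) = 1 + K * Q - K * (s / Q) - s ^+ k.
Proof.
have [s0 s1 K1 Q2 Q0] := param_bounds.
have [sQ0 sQ2 sQs sQQ] := sQ_bounds.
have [sk0 sk1 sks bern] := sk_bounds.
rewrite /dense_mass divfK; last by lra.
by rewrite mulrA.
Qed.

Lemma dense_slope_ge1 : 1 <= dense_slope.
Proof.
have [s0 s1 K1 Q2 Q0] := param_bounds.
have [sQ0 sQ2 sQs sQQ] := sQ_bounds.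
have [sk0 sk1 sks bern] := sk_bounds.
rewrite /dense_slope ler_pdivlMr ?mul1r; last by lra.
have Q1 : 0 < Q + 1 by lra.
rewrite -(ler_pM2r Q1) massM; move: sQ0 sQ2 sQs sQQ; set t := s / Q => t0 t1 ts e.
have : 0 <= (K - 1) * (Q - t) by rewrite mulr_ge0; lra.
lra.
Qed.

Lemma dense_slope_le : dense_slope <= K.
Proof.
have [s0 s1 K1 Q2 Q0] := param_bounds.
have [sQ0 sQ2 sQs sQQ] := sQ_bounds.
have [sk0 sk1 sks bern] := sk_bounds.
rewrite /dense_slope ler_pdivrMr; last by lra.
have Q1 : 0 < Q + 1 by lra.
rewrite -(ler_pM2r Q1) massM; move: sQ0 sQ2 sQs sQQ; set t := s / Q => t0 t1 ts e.
have -> : K * (1 - t) * (Q + 1) = K * Q + K - K * (t * Q) - K * t by ring.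
by rewrite e; lra.
Qed.

(** After clearing denominators this is Bernoulli's inequality at [s]. *)
Lemma period_mass_ge : K - (K - 1) / Q <= period_mass.
Proof.
have [s0 s1 K1 Q2 Q0] := param_bounds.
have [sQ0 sQ2 sQs sQQ] := sQ_bounds.
have [sk0 sk1 sks bern] := sk_bounds.
have QQ : 0 < Q * (Q + 1) by nra.
rewrite -(ler_pM2r QQ) /period_mass.
have -> : (dense_mass + s ^+ k / Q) * (Q * (Q + 1)) =
    dense_mass * (Q + 1) * Q + s ^+ k * (Q + 1) by field; lra.
rewrite massM.
have -> : (K - (K - 1) / Q) * (Q * (Q + 1)) = (K * Q - K + 1) * (Q + 1).
  by field; lra.
have -> : (1 + K * Q - K * (s / Q) - s ^+ k) * Q + s ^+ k * (Q + 1) =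
  (1 + K * Q) * Q - K * (s / Q * Q) + s ^+ k by ring.
rewrite sQQ; lra.
Qed.

Lemma period_mass_ge1 : 1 <= period_mass.
Proof.
have [s0 s1 K1 Q2 Q0] := param_bounds.
have [sQ0 sQ2 sQs sQQ] := sQ_bounds.
have [sk0 sk1 sks bern] := sk_bounds.
apply: le_trans period_mass_ge.
have : (K - 1) / Q <= K - 1 by rewrite ler_pdivrMr; nra.
lra.
Qed.

Let slopes_le : sparse_slope <= dense_slope.
Proof. exact: le_trans sparse_slope_le1 dense_slope_ge1. Qed.

(** Beyond one sparse stretch the guaranteed mass is linear in [l], while
    [l ^+ k] is convex; it suffices to compare at [l = s / Q] and at [l = 1].
    Within a sparse stretch, [l <= s] is enough. *)
Lemma room_short l m : 0 <= l <= 1 -> m <= l -> m <= s / Q ->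
  l ^+ k <= dense_slope * l - (dense_slope - sparse_slope) * m.
Proof.
have [s0 s1 K1 Q2 Q0] := param_bounds.
have [sQ0 sQ2 sQs sQQ] := sQ_bounds.
have [sk0 sk1 sks bern] := sk_bounds.
move=> /andP[l0 l1] ml ms; have [ls|sl] := leP l (s / Q).
  have : (dense_slope - sparse_slope) * m <= (dense_slope - sparse_slope) * l.
    by rewrite ler_wpM2l // subr_ge0.
  suff : l ^+ k <= sparse_slope * l by lra.
  rewrite -{1}(prednK k_gt0) exprSr ler_wpM2r // /sparse_slope.
  by rewrite lerXn2r ?nnegrE; lra.
have : (dense_slope - sparse_slope) * m <=
       (dense_slope - sparse_slope) * (s / Q) by rewrite ler_wpM2l // subr_ge0.
suff : l ^+ k <= dense_slope * (l - s / Q) + sparse_slope * (s / Q) by lra.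
have t1' : 0 < 1 - s / Q by lra.
(* Convexity between [s / Q], where [(s / Q) ^+ k <= s ^+ k / Q], and 1. *)
have chord : (1 - s / Q) * l ^+ k <=
    (1 - l) * (s / Q) ^+ k + (l - s / Q) * 1 ^+ k.
  by apply: pow_chord; lra.
have tk : (s / Q) ^+ k <= s ^+ k / Q.
  rewrite -sparse_massE -(prednK k_gt0) exprSr ler_wpM2r // /sparse_slope /=.
  by rewrite lerXn2r ?nnegrE ?ler_pdivrMr; nra.
rewrite -(ler_pM2l t1') (le_trans chord) // expr1n mulr1.
have -> : (1 - s / Q) * (dense_slope * (l - s / Q) + sparse_slope * (s / Q)) =
    dense_slope * (1 - s / Q) * (l - s / Q) +
    sparse_slope * (s / Q) * (1 - s / Q) by ring.
rewrite dense_massE sparse_massE.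
have p1 := period_mass_ge1; rewrite /period_mass in p1.
have : 0 <= (dense_mass + s ^+ k / Q - 1) * (l - s / Q).
  by rewrite mulr_ge0 // subr_ge0 // ltW.
have : 0 <= (s ^+ k / Q - (s / Q) ^+ k) * (1 - l).
  by rewrite mulr_ge0 // subr_ge0.
lra.
Qed.

(** The dense slope is at most [K], so the worst case is a whole number [j] of
    periods, where the claim follows from [period_mass_ge]. *)
Lemma room_long l m j : 0 <= j <= Q -> l <= j -> m <= j * (s / Q) ->
  1 + K * (l - 1) <= dense_slope * l - (dense_slope - sparse_slope) * m.
Proof.
have [s0 s1 K1 Q2 Q0] := param_bounds.
have [sQ0 sQ2 sQs sQQ] := sQ_bounds.
have [sk0 sk1 sks bern] := sk_bounds.
move=> /andP[j0 jQ] lj mj.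
have : (dense_slope - sparse_slope) * m <=
    (dense_slope - sparse_slope) * (j * (s / Q)).
  by rewrite ler_wpM2l // subr_ge0.
have : 0 <= (K - dense_slope) * (j - l).
  by rewrite mulr_ge0 // subr_ge0 ?dense_slope_le.
have e : dense_slope * j - (dense_slope - sparse_slope) * (j * (s / Q)) =
    j * period_mass.
  by rewrite /period_mass -dense_massE -sparse_massE; ring.
have : j * (K - (K - 1) / Q) + (K - 1) <= j * period_mass + (K - 1).
  by rewrite lerD2r ler_wpM2l // period_mass_ge.
have : 0 <= (K - 1) / Q * (Q - j).
  by rewrite mulr_ge0 ?subr_ge0 // divr_ge0; lra.
rewrite mulrBr divfK; last by lra.
lra.
Qed.

(** Again the worst case is the longest interval; there equality holds by the
    choice of [dense_mass]. *)
Lemma room_total l m : l <= Q + 1 - s / Q -> m <= s ->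
  1 + K * (l - 1) <= dense_slope * l - (dense_slope - sparse_slope) * m.
Proof.
have [s0 s1 K1 Q2 Q0] := param_bounds.
have [sQ0 sQ2 sQs sQQ] := sQ_bounds.
have [sk0 sk1 sks bern] := sk_bounds.
move=> lQ ms.
have : (dense_slope - sparse_slope) * m <= (dense_slope - sparse_slope) * s.
  by rewrite ler_wpM2l // subr_ge0.
have : 0 <= (K - dense_slope) * (Q + 1 - s / Q - l).
  by rewrite mulr_ge0 // subr_ge0 ?dense_slope_le.
have e : dense_slope * (Q + 1 - s / Q) - (dense_slope - sparse_slope) * s =
   dense_mass * (Q + 1) + s ^+ k.
  have -> : s ^+ k = sparse_slope * s by rewrite -exprSr prednK.
  apply/eqP; rewrite -dense_massE -subr_eq0; apply/eqP.
  transitivity (dense_slope * (s / Q * Q - s)); first by ring.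
  by rewrite sQQ subrr mulr0.
rewrite massM in e; lra.
Qed.

End Profile.

(** * Counting the points in sparse stretches *)
Section SparseCount.
Variables (T g : nat).
Hypotheses (T_gt0 : 0 < T) (gT : g <= T).

(** The number of points of [0, x) among the last [g] points of the periods of
    length [T]; the truncated subtraction counts those in the last, incomplete
    period. *)
Definition sparse_count (x : nat) : nat := (x %/ T) * g + (x %% T - (T - g)).

Lemma sparse_countD x j : sparse_count (x + j * T) = sparse_count x + j * g.
Proof. by rewrite addnC /sparse_count divnMDl // modnMDl; lia. Qed.

Lemma sparse_count_step x :
  sparse_count x <= sparse_count x.+1 <= (sparse_count x).+1.
Proof.
have e := divn_eq x T; have lt := ltn_pmod x T_gt0.
move: (x %/ T) (x %% T) e lt => m d -> lt.
have [ltS|geS] := ltnP d.+1 T.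
  have c z : z < T -> sparse_count (m * T + z) = m * g + (z - (T - g)).
    by move=> zT; rewrite /sparse_count divnMDl // modnMDl divn_small // modn_small // addn0.
  by rewrite -addnS !c //; lia.
have -> : (m * T + d).+1 = m.+1 * T by rewrite mulSn; lia.
rewrite /sparse_count divnMDl // modnMDl divn_small // modn_small // addn0.
by rewrite mulnK // modnMl mulSn; lia.
Qed.

Lemma sparse_count_mono x y : x <= y ->
  sparse_count x <= sparse_count y <= sparse_count x + (y - x).
Proof.
move=> /subnK <-; rewrite addnK; elim: (y - x) => [|d IHd].
  by rewrite add0n addn0 leqnn.
by rewrite addSn; have := sparse_count_step (d + x); lia.
Qed.

Lemma sparse_count_total q : sparse_count (q.+1 * T - g) = q * g.
Proof.
have -> : q.+1 * T - g = (T - g) + q * T by rewrite mulSn; lia.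
rewrite sparse_countD /sparse_count; have [->|g0] := posnP g.
  by rewrite !muln0; have := ltn_pmod (T - 0) T_gt0; lia.
by rewrite divn_small ?modn_small; lia.
Qed.

End SparseCount.

(** * The upper bound for fixed n *)
Section UpperBound.
Local Open Scope ring_scope.
Variable R : realType.

Lemma ffact_le_exp m k : (m ^_ k <= m ^ k)%N.
Proof.
elim: k => [|k IHk]; first by rewrite ffactn0 expn0.
by rewrite ffactnSr expnSr leq_mul // leq_subr.
Qed.

Lemma bin_le_pow m k : ('C(m, k))%:R <= m%:R ^+ k / (k`!)%:R :> R.
Proof.
rewrite ler_pdivlMr ?ltr0n ?fact_gt0 //.
by rewrite -natrM bin_ffact -natrX ler_nat ffact_le_exp.
Qed.

(** In the scale of [t] points, the tangent line of the power at 1 counts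
    [l - t] vertices per position, one for each choice of the other [k - 1]
    points. *)
Lemma tangent_scale k t l : (0 < k)%N -> (0 < t)%N -> (t <= l)%N ->
  t%:R ^+ k / (k`!)%:R * (1 + k%:R * (l%:R / t%:R - 1)) =
  t%:R ^+ k / (k`!)%:R + (l - t)%:R * (t%:R ^+ k.-1 / (k.-1`!)%:R) :> R.
Proof.
case: k => // k _; rewrite -(ltr0n R) => t0 tl.
rewrite natrB // factS natrM exprS -pred_Sn.
have f0 : (k`!)%:R != 0 :> R by rewrite pnatr_eq0 -lt0n fact_gt0.
have k0 : k.+1%:R != 0 :> R by rewrite pnatr_eq0.
move: (k.+1%:R) k0 (t%:R) t0 (k`!%:R) f0 => K K0 T /gt_eqF/negbT T0 f f0.
by field; rewrite f0 K0 T0.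
Qed.

Variables (n k b q g : nat).
Hypotheses (k_gt0 : (0 < k)%N) (q_gt1 : (1 < q)%N).
Local Notation T := b.+1.
Hypotheses (qgT : (q * g <= T)%N) (ngT : (n.+1 + g <= q.+1 * T)%N).

Let s : R := (q * g)%:R / T%:R.
Let scale : R := T%:R ^+ k / (k`!)%:R.

Let T0 : (0 : R) < T%:R. Proof. by rewrite ltr0n. Qed.

Let s01 : 0 <= s <= 1.
Proof.
have T0' := T0.
by rewrite /s divr_ge0 ?ler0n //= ler_pdivrMr // mul1r ler_nat.
Qed.

Let scale_ge0 : 0 <= scale.
Proof. by rewrite divr_ge0 ?exprn_ge0 ?ler0n. Qed.

Let sq : s / q%:R = g%:R / T%:R.
Proof.
have T0' := T0; have q0 : (0 : R) < q%:R by rewrite ltr0n; lia.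
by rewrite /s natrM -mulrA mulrAC divff ?mul1r // gt_eqF.
Qed.

(** The three room lemmas apply according to the number of periods in the
    interval.  An interval of at most [j] periods meets at most [j * g] sparse
    points; any interval of [0, n] meets at most [q * g] of them, because
    the sparse stretch of the period [q + 1] starts after [n]. *)
Lemma card_inside_le x y : (x < y <= n.+1)%N ->
  (#|inside n k b x y|)%:R <= scale * (dense_slope k q s * ((y - x)%:R / T%:R)
   - (dense_slope k q s - sparse_slope k s) *
     ((sparse_count T g y - sparse_count T g x)%:R / T%:R)).
Proof.
move=> /andP[xy yn]; have T0' := T0.
have gT : (g <= T)%N by apply: leq_trans qgT; rewrite leq_pmull //; lia.
have gap := @sparse_count_mono T g isT gT.
have /andP[C_mono C_le] := gap _ _ (ltnW xy).
set L := (y - x)%N; set G := (_ - _)%N.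
have GL : (G <= L)%N by rewrite /G /L; lia.
have Gj j : (L <= j * T)%N -> (G <= j * g)%N.
  move=> Lj; have : (y <= x + j * T)%N by rewrite -leq_subLR.
  move=> /gap /andP[]; rewrite sparse_countD // /G; lia.
have Gq : (G <= q * g)%N.
  have : (y <= q.+1 * T - g)%N by lia.
  by move=> /gap /andP[]; rewrite sparse_count_total // /G; lia.
have [LT|TL] := leqP L T.
  rewrite card_inside_short //; last by rewrite -leq_subLR.
  apply: le_trans (bin_le_pow _ _) _.
  have -> : (y - x)%:R ^+ k / (k`!)%:R = scale * (L%:R / T%:R) ^+ k.
    rewrite /scale expr_div_n -/L [RHS]mulrC mulrA divfK //.
    by rewrite gt_eqF ?exprn_gt0.
  rewrite ler_wpM2l //; apply: room_short => //.
  - by rewrite divr_ge0 ?ler0n //= ler_pdivrMr // mul1r ler_nat.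
  - by rewrite ler_pM2r ?invr_gt0 // ler_nat.
  - by rewrite sq ler_pM2r ?invr_gt0 // ler_nat -(mul1n g) Gj // mul1n.
have -> : y = (x + T + (L - T))%N by rewrite /L; lia.
rewrite card_inside_long //; last by lia.
apply: (@le_trans _ _ (scale * (1 + k%:R * (L%:R / T%:R - 1)))).
  have -> : scale * (1 + k%:R * (L%:R / T%:R - 1)) =
     T%:R ^+ k / (k`!)%:R + (L - T)%:R * (T%:R ^+ k.-1 / (k.-1`!)%:R).
    exact: tangent_scale (ltnW TL).
  rewrite natrD natrM lerD ?bin_le_pow // ler_wpM2l //.
  apply: le_trans (bin_le_pow _ _) _.
  rewrite ler_pM2r ?invr_gt0 ?ltr0n ?fact_gt0 //.
  by rewrite lerXn2r ?nnegrE ?ler0n // ler_nat.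
rewrite ler_wpM2l //.
(* [L / T] rounded up *)
pose j := (L.-1 %/ T).+1.
have Lj : (L <= j * T)%N.
  by rewrite /j; have := ltn_ceil L.-1 (isT : (0 < T)%N); lia.
have [jq|qj] := leqP j q.
  apply: (@room_long _ _ _ _ _ _ _ _ _ j%:R) => //.
  - by rewrite ler0n ler_nat.
  - by rewrite ler_pdivrMr // -natrM ler_nat.
  - by rewrite sq mulrA ler_pM2r ?invr_gt0 // -natrM ler_nat Gj.
apply: room_total => //.
  rewrite sq ler_pdivrMr // mulrBl divfK ?gt_eqF // lerBrDr.
  by rewrite natr1 -natrD -natrM ler_nat /L; lia.
by rewrite ler_pM2r ?invr_gt0 // ler_nat.
Qed.

(** Rounding the real profile down to integers keeps the integral room
    condition and increases the growth over a period by at most 1. *)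
Theorem bandwidth_upper :
  (bandwidth_G n k b)%:R <= scale * period_mass k q s + 1.
Proof.
have T0' := T0.
have gT : (g <= T)%N by apply: leq_trans qgT; rewrite leq_pmull //; lia.
have gap := @sparse_count_mono T g isT gT.
pose d := dense_slope k q s; pose e := sparse_slope k s.
have d1 : 1 <= d by apply: dense_slope_ge1.
have e0 : 0 <= e by apply: sparse_slope_ge0.
have e1 : e <= 1 by apply: sparse_slope_le1.
pose C := sparse_count T g.
pose F x : R := scale / T%:R * (d * x%:R - (d - e) * (C x)%:R).
have F_diff x y : (x <= y)%N -> F y - F x =
    scale * (d * ((y - x)%:R / T%:R) - (d - e) * ((C y - C x)%N%:R / T%:R)).
  move=> xy; have /andP[CC _] := gap _ _ xy.
  by rewrite /F !natrB //; ring.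
have F_mono x y : (x <= y)%N -> F x <= F y.
  move=> xy; rewrite -subr_ge0 F_diff // mulr_ge0 //.
  have /andP[CC CL] := gap _ _ xy.
  have : ((C y - C x)%N%:R : R) <= (y - x)%:R by rewrite ler_nat /C; lia.
  rewrite !mulrA -mulrBl => le; rewrite divr_ge0 ?ler0n // subr_ge0.
  have : 0 <= ((C y - C x)%N%:R : R) by rewrite ler0n.
  nra.
have C0 : C 0%N = 0%N by rewrite /C /sparse_count div0n mod0n.
have F_ge0 x : 0 <= F x.
  by apply: le_trans (F_mono 0%N x isT); rewrite /F C0 !mulr0 subrr mulr0.
have F_window x : F (x + T)%N = F x + scale * period_mass k q s.
  rewrite -[LHS](subrK (F x)) addrC F_diff ?leq_addr //; congr (_ + _ * _).
  have -> : C (x + T)%N = (C x + g)%N.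
    by rewrite /C -[X in (x + X)%N](mul1n T) sparse_countD // mul1n.
  rewrite !addKn divff ?gt_eqF //.
  rewrite -sq -/d -/e /period_mass -dense_massE // -sparse_massE // -/d -/e.
  by ring.
pose m := Num.truncn (scale * period_mass k q s).
have sp_ge0 : 0 <= scale * period_mass k q s.
  by rewrite mulr_ge0 // (le_trans ler01) // period_mass_ge1.
have le_m : (m%:R : R) <= scale * period_mass k q s.
  by rewrite /m truncn_le.
suff : (bandwidth_G n k b <= m.+1)%N.
  by rewrite -(ler_nat R) -natr1; move=> /le_trans; apply; rewrite lerD2r.
apply: (@bandwidth_le_profile _ _ _ k_gt0 (fun x => Num.truncn (F x))).
- by move=> x y xy; apply: le_truncn; apply: F_mono.
- move=> x y xy; have := card_inside_le xy; rewrite -F_diff; last by lia.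
  rewrite lerBrDl => le.
  rewrite leq_subRL; last by apply: le_truncn; apply: F_mono; lia.
  rewrite truncn_ge_nat // natrD.
  by apply: le_trans le; rewrite lerD2r truncn_le.
- move=> x; rewrite -ltnS.
  rewrite truncn_lt_nat // F_window.
  have h1 := truncnS_gt (F x); have h2 := truncnS_gt (scale * period_mass k q s).
  rewrite -/m in h2; rewrite -addnS addnS -addSn natrD; lra.
Qed.

End UpperBound.

Local Open Scope classical_set_scope.
Local Open Scope ring_scope.

(** * Sequences of natural numbers of polynomial growth *)
Section Scaling.
Variable R : realType.
Implicit Types (u v : nat -> nat) (l m : R) (k : nat).

Lemma cvg_near_eq (f g : nat -> R) l :
  (\forall n \near \oo, f n = g n) -> f @ \oo --> l -> g @ \oo --> l.
Proof. by move=> fg; apply: cvg_trans; apply: near_eq_cvg. Qed.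

Lemma seq_cvgD (f g : nat -> R) l m : f @ \oo --> l -> g @ \oo --> m ->
  (fun n => f n + g n) @ \oo --> l + m.
Proof. exact: cvgD. Qed.

Lemma seq_cvgB (f g : nat -> R) l m : f @ \oo --> l -> g @ \oo --> m ->
  (fun n => f n - g n) @ \oo --> l - m.
Proof. exact: cvgB. Qed.

Lemma seq_cvgM (f g : nat -> R) l m : f @ \oo --> l -> g @ \oo --> m ->
  (fun n => f n * g n) @ \oo --> l * m.
Proof. exact: cvgM. Qed.

Lemma seq_cvg_cst l : (fun _ : nat => l) @ \oo --> l.
Proof. exact: cvg_cst. Qed.
Arguments seq_cvg_cst l : clear implicits.

Lemma seq_cvg_norm (f : nat -> R) l : f @ \oo --> l ->
  (fun n => `|f n|) @ \oo --> `|l|.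
Proof. exact: cvg_norm. Qed.

Lemma cvg_pow (f : nat -> R) l k :
  f @ \oo --> l -> (fun n => f n ^+ k) @ \oo --> l ^+ k.
Proof.
move=> fl; elim: k => [|k IHk]; first by rewrite expr0; apply: seq_cvg_cst.
rewrite exprS; apply: (cvg_near_eq _ (seq_cvgM fl IHk)).
by near=> n; rewrite /= exprS.
Unshelve. all: by end_near. Qed.

Lemma cvg_maxr (f g : nat -> R) l m : f @ \oo --> l -> g @ \oo --> m ->
  (fun n => Num.max (f n) (g n)) @ \oo --> Num.max l m.
Proof.
move=> fl gm; rewrite maxr_absE.
have h := seq_cvgM (seq_cvgD (seq_cvgD fl gm) (seq_cvg_norm (seq_cvgB fl gm))) (seq_cvg_cst (2^-1 : R)).
by apply: (cvg_near_eq _ h); near=> n; rewrite maxr_absE.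
Unshelve. all: by end_near. Qed.

Definition scales k u l := (fun n => (u n)%:R / n%:R ^+ k) @ \oo --> l.

Lemma scales_near_eq k u v l :
  (\forall n \near \oo, u n = v n) -> scales k u l -> scales k v l.
Proof.
by move=> uv; apply: cvg_near_eq; near=> n; congr (_%:R / _); near: n.
Unshelve. all: by end_near. Qed.

Lemma cvg_inv_nat : (fun n => (n%:R : R)^-1) @ \oo --> (0 : R).
Proof.
apply/(gtr0_cvgV0 (f := fun n => n%:R : R)); last exact: cvgr_idn.
by near=> n; rewrite ltr0n; near: n; apply: nbhs_infty_gt.
Unshelve. all: by end_near. Qed.

Lemma scales_bounded u c k : (0 < k)%N -> (forall n, (u n <= c)%N) ->
  scales k u 0.
Proof.
move=> k0 uc; apply: (@squeeze_cvgr _ _ _ _ (fun=> 0)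
  (fun n => c%:R * (n%:R^-1) ^+ k) _ _ _ (seq_cvg_cst _)); last first.
  have := seq_cvgM (seq_cvg_cst (c%:R : R)) (cvg_pow (k := k) cvg_inv_nat).
  by rewrite expr0n (gtn_eqF k0) mulr0n mulr0.
near=> n; rewrite divr_ge0 ?exprn_ge0 ?ler0n //= exprVn.
by rewrite ler_wpM2r ?invr_ge0 ?exprn_ge0 ?ler0n // ler_nat.
Unshelve. all: by end_near. Qed.

Lemma scales_id : scales 1 id 1.
Proof.
apply: (cvg_near_eq _ (seq_cvg_cst (1 : R))); near=> n.
rewrite expr1 divff // pnatr_eq0 -lt0n.
by near: n; apply: nbhs_infty_gt.
Unshelve. all: by end_near. Qed.

Lemma scalesD k u v l m : scales k u l -> scales k v m ->
  scales k (fun n => u n + v n)%N (l + m).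
Proof.
move=> ul vm; apply: (cvg_near_eq _ (seq_cvgD ul vm)).
by near=> n; rewrite /= natrD mulrDl.
Unshelve. all: by end_near. Qed.

Lemma scalesM k k' u v l m : scales k u l -> scales k' v m ->
  scales (k + k') (fun n => u n * v n)%N (l * m).
Proof.
move=> ul vm; apply: (cvg_near_eq _ (seq_cvgM ul vm)).
by near=> n; rewrite /= natrM exprD invfM mulrACA.
Unshelve. all: by end_near. Qed.

Lemma scalesMl c k u l : scales k u l ->
  scales k (fun n => c * u n)%N (c%:R * l).
Proof.
move=> ul; apply: (cvg_near_eq _ (seq_cvgM (seq_cvg_cst (c%:R : R)) ul)).
by near=> n; rewrite natrM mulrA.
Unshelve. all: by end_near. Qed.

(** The subtraction truncates, whence the maximum. *)
Lemma scalesB k u v l m : scales k u l -> scales k v m ->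
  scales k (fun n => u n - v n)%N (Num.max 0 (l - m)).
Proof.
move=> ul vm; apply: (cvg_near_eq _ (cvg_maxr (seq_cvg_cst (0 : R)) (seq_cvgB ul vm))).
near=> n; rewrite /= -mulrBl -(mul0r (n%:R ^+ k)^-1).
rewrite -maxr_pMl ?invr_ge0 ?exprn_ge0 //; congr (_ * _).
case: (leqP (v n) (u n)) => [vu|/ltnW uv].
  by rewrite natrB //; apply/max_idPr; rewrite subr_ge0 ler_nat.
have /eqP -> : (u n - v n == 0)%N by rewrite subn_eq0.
by apply/max_idPl; rewrite subr_le0 ler_nat.
Unshelve. all: by end_near. Qed.

Lemma scales_lt k u v l m : scales k u l -> scales k v m -> l < m ->
  \forall n \near \oo, (u n < v n)%N.
Proof.
move=> ul vm lm; have lt : 0 < m - l by rewrite subr_gt0.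
near=> n.
have : 0 < (v n)%:R / n%:R ^+ k - (u n)%:R / n%:R ^+ k :> R.
  by near: n; apply: cvgr_gt lt; apply: seq_cvgB.
rewrite -mulrBl ltnNge; apply: contraTN => vu; rewrite -leNgt.
by rewrite mulr_le0_ge0 ?subr_le0 ?ler_nat // invr_ge0 exprn_ge0.
Unshelve. all: by end_near. Qed.

Lemma scales_divn q u l : (0 < q)%N -> scales 1 u l ->
  scales 1 (fun n => u n %/ q)%N (l / q%:R).
Proof.
move=> q0 ul.
have mod0 : scales 1 (fun n => u n %% q)%N 0.
  by apply: (@scales_bounded _ q) => // n; rewrite ltnW // ltn_mod.
have h := seq_cvgM (seq_cvgB ul mod0) (seq_cvg_cst (q%:R^-1 : R)); rewrite subr0 in h.
apply: (cvg_near_eq _ h); near=> n.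
rewrite /= -mulrBl [in (u n)%:R](divn_eq (u n) q) natrD addrK natrM.
by rewrite mulrAC mulfK // pnatr_eq0 -lt0n.
Unshelve. all: by end_near. Qed.

Lemma scales_bin k u l : 0 <= l -> scales 1 u l ->
  scales k (fun n => 'C(u n, k)) (l ^+ k / (k`!)%:R).
Proof.
move=> l0 ul.
have f0 : (k`!)%:R != 0 :> R by rewrite pnatr_eq0 -lt0n fact_gt0.
suff h : scales k (fun n => u n ^_ k)%N (l ^+ k).
  apply: (cvg_near_eq _ (seq_cvgM h (seq_cvg_cst ((k`!)%:R^-1 : R)))); near=> n.
  by rewrite -bin_ffact natrM mulrAC mulfK.
elim: k {f0} => [|k IHk].
  by apply: (cvg_near_eq _ (seq_cvg_cst (1 : R))); near=> n; rewrite ffactn0 divr1.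
have sub : scales 1 (fun n => u n - k)%N l.
  have h := scalesB ul (@scales_bounded (fun=> k) k 1 isT (fun=> leqnn k)).
  by rewrite subr0 (max_idPr l0) in h.
have := scalesM IHk sub; rewrite addn1 -exprSr.
by apply: scales_near_eq; near=> n; rewrite ffactnSr.
Unshelve. all: by end_near. Qed.

End Scaling.
Arguments seq_cvg_cst {R} l [t] _.

(** * The constants *)
Section Constants.
Variable R : realType.
Implicit Types (beta r : R) (k q : nat).

(** [c1] comes from the vertices inside an interval of [q * beta * n] points:
    their number in units of [n ^+ k], over [q]. *)
Lemma c1E k q beta : (0 < k)%N -> (0 < q)%N ->
  c1 beta k q = (beta ^+ k / (k`!)%:R +
    (q%:R * beta - beta) * (beta ^+ k.-1 / (k.-1`!)%:R)) / q%:R.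
Proof.
case: k => // k _ q0; rewrite /c1 factS natrM exprS -pred_Sn.
have f0 : (k`!)%:R != 0 :> R by rewrite pnatr_eq0 -lt0n fact_gt0.
have K0 : k.+1%:R != 0 :> R by rewrite pnatr_eq0.
have Q0 : q%:R != 0 :> R by rewrite pnatr_eq0 -lt0n.
move: (k`!%:R) f0 (k.+1%:R) K0 (q%:R) Q0 => f f0 K K0 Q Q0.
by field; rewrite f0 K0 Q0.
Qed.

(** At [s = 1] the growth of the profile is [c1]. *)
Lemma c1_period_mass k q beta : (0 < q)%N ->
  beta ^+ k / (k`!)%:R * period_mass k q 1 = c1 beta k q.
Proof.
move=> q0; rewrite /c1 /period_mass /dense_mass expr1n.
have f0 : (k`!)%:R != 0 :> R by rewrite pnatr_eq0 -lt0n fact_gt0.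
have Q0 : q%:R != 0 :> R by rewrite pnatr_eq0 -lt0n.
have Q1 : q%:R + 1 != 0 :> R by rewrite natr1 pnatr_eq0.
move: (k`!%:R) f0 (k%:R) (q%:R) Q0 Q1 => f f0 K Q Q0 Q1.
by field; rewrite f0 Q0 Q1.
Qed.

(** In units of [n ^+ k], the first two terms count the vertices of the graph
    and the third the [k]-subsets of the overlap of [q + 1] windows. *)
Lemma c2_c3E k q beta r : (0 < k)%N -> (0 < q)%N ->
  c2 beta k q + 1 / q%:R ^+ (k - 1) * c3 beta k q r =
  (beta ^+ k / (k`!)%:R + (1 - beta) * (beta ^+ k.-1 / (k.-1`!)%:R) +
    (beta - r) ^+ k / (k`!)%:R) / q.+1%:R.
Proof.
case: k => // k _ q0; rewrite /c2 /c3 subn1 factS natrM !exprS -pred_Sn.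
have -> : q.+1%:R = q%:R + 1 :> R by rewrite natr1.
have f0 : (k`!)%:R != 0 :> R by rewrite pnatr_eq0 -lt0n fact_gt0.
have K0 : k.+1%:R != 0 :> R by rewrite pnatr_eq0.
have Q0 : q%:R != 0 :> R by rewrite pnatr_eq0 -lt0n.
have Q1 : q%:R + 1 != 0 :> R by rewrite natr1 pnatr_eq0.
move: (k`!%:R) f0 (k.+1%:R) K0 (q%:R) Q0 Q1
  => f f0 K K0 Q Q0 Q1.
by field; rewrite Q1 f0 K0 expf_neq0.
Qed.

Lemma c2_c3_period_mass k q beta r : (0 < k)%N -> (0 < q)%N ->
  beta != 0 -> 1 = q%:R * beta + r ->
  beta ^+ k / (k`!)%:R * period_mass k q (q%:R * (beta - r) / beta) =
  c2 beta k q + c3 beta k q r.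
Proof.
case: k => // k _ q0 b0 e.
rewrite /c2 /c3 /period_mass /dense_mass subn1 !exprMn exprVn !exprS -pred_Sn.
have f0 : (k.+1`!)%:R != 0 :> R by rewrite pnatr_eq0 -lt0n fact_gt0.
have Q0 : q%:R != 0 :> R by rewrite pnatr_eq0 -lt0n.
have P0 : beta ^+ k != 0 :> R by rewrite expf_neq0.
have Q1 : q%:R + 1 != 0 :> R by rewrite natr1 pnatr_eq0.
have -> : r = 1 - q%:R * beta by rewrite [X in X - _]e addrC addKr.
move: (k.+1`!%:R) f0 (k.+1%:R) (beta ^+ k) P0 (q%:R) Q0 Q1
   (q%:R ^+ k) ((beta - (1 - q%:R * beta)) ^+ k) => f f0 K P P0 Q Q0 Q1 S U.
by field; rewrite b0 f0 Q0 P0 Q1.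
Qed.

Lemma c1_gt0 k q beta : (0 < k)%N -> (0 < q)%N -> 0 < beta ->
  0 < c1 beta k q.
Proof.
move=> k0 q0 b0; rewrite c1E // divr_gt0 ?ltr0n //.
have q1 : 1 <= q%:R :> R by rewrite ler1n.
rewrite ltr_pwDl ?divr_gt0 ?exprn_gt0 ?ltr0n ?fact_gt0 //.
rewrite mulr_ge0 ?divr_ge0 ?exprn_ge0 ?ler0n // ?(ltW b0) //.
by rewrite subr_ge0 ler_peMl // ltW.
Qed.

Lemma c2_c3_gt0 k q beta r : (0 < k)%N -> 0 < beta -> beta <= 1 ->
  r <= beta -> 0 < c2 beta k q + c3 beta k q r.
Proof.
move=> k0 b0 b1 rb; have k1 : 1 <= k%:R :> R by rewrite ler1n.
have f0 : 0 < (q%:R + 1) * (k`!)%:R :> R.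
  by rewrite natr1 mulr_gt0 ?ltr0n ?fact_gt0.
rewrite ltr_pwDl //; first by rewrite mulr_gt0 ?divr_gt0 ?exprn_gt0 //; nra.
by rewrite mulr_ge0 ?divr_ge0 ?exprn_ge0 ?ler0n ?subr_ge0 // ltW.
Qed.

End Constants.

(** * Asymptotics *)
Section Asymptotics.
Variable R : realType.
Implicit Types (u v : nat -> nat) (f g x : nat -> R) (c l m : R).

Lemma scales_min k u v l m : 0 <= l -> 0 <= m -> scales k u l ->
  scales k v m -> scales k (fun n => minn (u n) (v n)) (Num.min l m).
Proof.
move=> l0 m0 ul vm.
have -> : Num.min l m = Num.max 0 (l - Num.max 0 (l - m)).
  have [lm|ml] := leP l m.
    have -> : Num.max 0 (l - m) = 0 by apply/max_idPl; rewrite subr_le0.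
    by rewrite subr0; apply/esym/max_idPr.
  have -> : Num.max 0 (l - m) = l - m by apply/max_idPr; rewrite subr_ge0 ltW.
  by rewrite opprB addrC subrK; apply/esym/max_idPr.
apply: scales_near_eq (scalesB ul (scalesB ul vm)).
by near=> n; rewrite minnE.
Unshelve. all: by end_near. Qed.

Lemma asymp_le_upper f x g c : 0 < c -> x @ \oo --> c ->
  (\forall n \near \oo, f n <= x n * g n) ->
  asymp_le f (fun n => c * g n).
Proof.
move=> c0 xc fx; exists (fun n => x n / c - 1).
  have := seq_cvgB (seq_cvgM xc (seq_cvg_cst c^-1)) (seq_cvg_cst 1).
  by rewrite divff ?subrr // gt_eqF.
near=> n; rewrite addrC subrK mulrA divfK ?gt_eqF //.
by near: n.
Unshelve. all: by end_near. Qed.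

Lemma asymp_le_lower f x g c : 0 < c -> x @ \oo --> c ->
  (forall n, 0 <= g n) -> (\forall n \near \oo, x n * g n <= f n) ->
  asymp_le (fun n => c * g n) f.
Proof.
move=> c0 xc g0 fx; exists (fun n => c * (x n)^-1 - 1).
  have h : (fun n => (x n)^-1) @ \oo --> c^-1.
    by apply: cvgV xc; rewrite gt_eqF.
  have := seq_cvgB (seq_cvgM (seq_cvg_cst c) h) (seq_cvg_cst 1).
  by rewrite divff ?subrr // gt_eqF.
near=> n; have x0 : 0 < x n by near: n; apply: cvgr_gt c0.
rewrite addrC subrK -mulrA ler_wpM2l ?(ltW c0) // mulrC ler_pdivlMr // mulrC.
by near: n.
Unshelve. all: by end_near. Qed.

Lemma asymp_eq_squeeze f x y g c : 0 < c -> x @ \oo --> c -> y @ \oo --> c ->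
  (\forall n \near \oo, 0 < g n) ->
  (\forall n \near \oo, x n * g n <= f n) ->
  (\forall n \near \oo, f n <= y n * g n) ->
  f ~_\oo (fun n => c * g n).
Proof.
move=> c0 xc yc g0 fx fy.
apply/asymp_eqP; exists (fun n => f n / g n / c - 1); last first.
  near=> n; have gn : 0 < g n by near: n.
  rewrite addrC subrK mulrA divfK ?gt_eqF //.
  by rewrite divfK // gt_eqF.
have lim z : z @ \oo --> c -> (fun n => z n / c - 1) @ \oo --> (0 : R).
  move=> zc; have := seq_cvgB (seq_cvgM zc (seq_cvg_cst c^-1)) (seq_cvg_cst 1).
  by rewrite divff ?subrr // gt_eqF.
apply: (squeeze_cvgr _ (lim _ xc) (lim _ yc)); near=> n.
have gn : 0 < g n by near: n.
rewrite !lerD2r !ler_pM2r ?invr_gt0 // ler_pdivlMr // ler_pdivrMr //.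
by apply/andP; split; near: n.
Unshelve. all: by end_near. Qed.

Lemma cvg_period_mass k q (s : nat -> R) l : s @ \oo --> l ->
  (fun n => period_mass k q (s n)) @ \oo --> period_mass k q l.
Proof.
move=> sl; rewrite /period_mass /dense_mass.
have p := cvg_pow (k := k) sl.
apply: seq_cvgD; last exact: seq_cvgM p (seq_cvg_cst _).
apply: seq_cvgM (seq_cvg_cst _); apply: seq_cvgB p.
apply: seq_cvgB (seq_cvg_cst _) _.
by apply: seq_cvgM (seq_cvg_cst _); apply: seq_cvgM (seq_cvg_cst _) sl.
Qed.

Section Bandwidth.
Variables (k q : nat) (beta r : R) (b : nat -> nat).
Hypotheses (k_gt0 : (0 < k)%N) (q_gt1 : (1 < q)%N).
Hypotheses (beta_gt0 : 0 < beta) (r_ge0 : 0 <= r) (r_lt : r < beta).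
Hypothesis beta_r : 1 = q%:R * beta + r.
Hypothesis b_beta : scales 1 b beta.
Local Notation B := (fun n => (bandwidth_G n k (b n))%:R : R).

Let T_beta : scales 1 (fun n => (b n).+1) beta.
Proof.
have h := scalesD b_beta (@scales_bounded R (fun=> 1%N) 1 1 isT (fun=> leqnn _)).
rewrite addr0 in h; apply: scales_near_eq h.
by near=> n; rewrite addn1.
Unshelve. all: by end_near. Qed.

Let const0 (a : nat) : scales 1 (fun=> a) (0 : R).
Proof. by apply: (@scales_bounded _ _ a). Qed.

Let S_1 : scales 1 (fun n => n.+1) (1 : R).
Proof.
have h := scalesD (@scales_id R) (const0 1); rewrite addr0 in h.
by apply: scales_near_eq h; near=> n; rewrite addn1.
Unshelve. all: by end_near. Qed.

Let reach n := (q * ((b n).+1 - k) + k)%N.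

Let reach_lim : scales 1 reach (q%:R * beta).
Proof.
have h := scalesD (scalesMl (c := q) (scalesB T_beta (const0 k))) (const0 k).
by rewrite subr0 (max_idPr (ltW beta_gt0)) addr0 in h.
Qed.

Let k_le : \forall n \near \oo, (k <= (b n).+1)%N.
Proof.
have := scales_lt (const0 k) T_beta beta_gt0.
by apply: filterS => n /ltnW.
Qed.

Let q_beta : 2 * beta <= q%:R * beta /\ q%:R * beta <= 1.
Proof. by rewrite ler_pM2r // ler_nat; split=> //; move: beta_r r_ge0; lra. Qed.

Let b_le : \forall n \near \oo, (b n <= n)%N.
Proof.
have h : beta < 1 by have [] := q_beta; move: beta_gt0; lra.
have := scales_lt b_beta (@scales_id R) h.
by apply: filterS => n /ltnW.
Qed.

Lemma lower_ratio u (c : nat) l : (0 < c)%N -> scales k u l ->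
  (\forall n \near \oo, (u n <= c * bandwidth_G n k (b n))%N) ->
  exists2 x : nat -> R, x @ \oo --> l / c%:R &
    \forall n \near \oo, x n * n%:R ^+ k <= B n.
Proof.
move=> c0 ul le; exists (fun n => (u n)%:R / n%:R ^+ k / c%:R).
  exact: seq_cvgM ul (seq_cvg_cst _).
near=> n; rewrite mulrAC divfK; last first.
  rewrite expf_neq0 // pnatr_eq0 -lt0n; near: n; exact: nbhs_infty_gt.
rewrite ler_pdivrMr ?ltr0n // -natrM ler_nat mulnC.
by near: n.
Unshelve. all: by end_near. Qed.

Let count y n := ('C((b n).+1, k) + (y - (b n).+1) * 'C(b n, k.-1))%N.

Let count_lim (y : nat -> nat) l : scales 1 y l -> beta <= l ->
  scales k (fun n => count (y n) n) (beta ^+ k / (k`!)%:R +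
    (l - beta) * (beta ^+ k.-1 / (k.-1`!)%:R)).
Proof.
move=> yl bl; have b0 := ltW beta_gt0; apply: scalesD.
  exact: scales_bin.
have h := scalesM (scalesB yl T_beta) (scales_bin (k := k.-1) b0 b_beta).
rewrite add1n prednK // (max_idPr _) ?subr_ge0 // in h.
Qed.

(** Already the vertices inside an interval of [q (b + 1 - k) + k] points
    force [c1]. *)
Lemma clique_chain_bound :
  exists2 x : nat -> R, x @ \oo --> c1 beta k q &
    \forall n \near \oo, x n * n%:R ^+ k <= B n.
Proof.
have Q2 : 2 <= q%:R :> R by rewrite ler_nat.
have [qb2 qb1] := q_beta.
pose y n := minn n.+1 (reach n).
have yl : scales 1 y (q%:R * beta).
  have qb0 : 0 <= q%:R * beta by move: beta_gt0; lra.
  by have h := scales_min ler01 qb0 S_1 reach_lim; rewrite (min_idPr qb1) in h.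
have bl : beta <= q%:R * beta by move: beta_gt0; lra.
have h := scalesB (count_lim yl bl) (@scales_bounded R (fun=> 1%N) 1 k k_gt0 (fun=> leqnn _)).
have -> : c1 beta k q = (Num.max 0 (beta ^+ k / (k`!)%:R +
    (q%:R * beta - beta) * (beta ^+ k.-1 / (k.-1`!)%:R) - 0)) / q%:R.
  rewrite c1E ?(ltnW q_gt1) // subr0 (max_idPr _) // addr_ge0 ?mulr_ge0 //;
    by rewrite ?subr_ge0 ?invr_ge0 ?mulr_ge0 ?invr_ge0 ?exprn_ge0 ?ler0n ?(ltW beta_gt0).
apply: lower_ratio h _; first by lia.
near=> n; rewrite leq_subLR add1n.
have Ty : ((b n).+1 <= y n)%N.
  apply: ltnW; near: n; apply: scales_lt T_beta yl _; move: beta_gt0; lra.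
have kT : (k <= (b n).+1)%N by near: n.
have yn : (y n <= n.+1)%N by rewrite geq_minl.
have -> : count (y n) n = #|inside n k (b n) 0 (y n)|.
  have -> : y n = (0 + (b n).+1 + (y n - (b n).+1))%N by lia.
  by rewrite card_inside_long // /count; lia.
apply: card_le_bandwidth => //; first by lia.
by rewrite geq_minr.
Unshelve. all: by end_near. Qed.

Lemma overlap_bound :
  exists2 x : nat -> R,
    x @ \oo --> c2 beta k q + 1 / q%:R ^+ (k - 1) * c3 beta k q r &
    \forall n \near \oo, x n * n%:R ^+ k <= B n.
Proof.
have Q2 : 2 <= q%:R :> R by rewrite ler_nat.
have [qb2 qb1] := q_beta.
have br0 : 0 <= beta - r by rewrite subr_ge0 ltW.
pose rr n := (n.+1 - reach n)%N.
have rl : scales 1 rr r.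
  have h := scalesB S_1 reach_lim.
  have e : 1 - q%:R * beta = r by move: beta_r; lra.
  by rewrite e (max_idPr r_ge0) in h.
have Ml : scales k (fun n => 'C((b n).+1 - rr n, k)) ((beta - r) ^+ k / (k`!)%:R).
  by apply: scales_bin => //; have h := scalesB T_beta rl;
    rewrite (max_idPr br0) in h.
have bl : beta <= 1 by move: beta_gt0; lra.
have h := scalesB (scalesD (count_lim S_1 bl) Ml)
  (@scales_bounded R (fun=> 2%N) 2 k k_gt0 (fun=> leqnn _)).
have -> : c2 beta k q + 1 / q%:R ^+ (k - 1) * c3 beta k q r =
  (Num.max 0 (beta ^+ k / (k`!)%:R + (1 - beta) * (beta ^+ k.-1 / (k.-1`!)%:R) +
    (beta - r) ^+ k / (k`!)%:R - 0)) / q.+1%:R.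
  rewrite c2_c3E ?(ltnW q_gt1) // subr0 (max_idPr _) // !addr_ge0 ?mulr_ge0 //;
    by rewrite ?subr_ge0 ?invr_ge0 ?mulr_ge0 ?invr_ge0 ?exprn_ge0 ?ler0n ?(ltW beta_gt0).
have rk : \forall n \near \oo, (rr n + k < (b n).+1)%N.
  by apply: scales_lt T_beta r_lt; have := scalesD rl (const0 k); rewrite addr0.
apply: lower_ratio h _ => //.
near=> n; rewrite leq_subLR [leqRHS]addnC.
have kT : (k <= (b n).+1)%N by near: n.
have bn : (b n <= n)%N by near: n.
have -> : count n.+1 n = #|G_vertex n k (b n)|.
  rewrite card_G_vertex //.
  have -> : n.+1 = (0 + (b n).+1 + (n.+1 - (b n).+1))%N by lia.
  by rewrite card_inside_long // /count; lia.
apply: card_overlap_le_bandwidth => //; first by lia.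
rewrite -/(reach n) -/(rr n).
by apply: ltnW; near: n.
Unshelve. all: by end_near. Qed.

(** The sparse stretches are taken as long as the two constraints of
    [bandwidth_upper] allow; the larger the sparse stretch, the smaller the
    growth per period. *)
Lemma profile_bound s : s = Num.min 1 (q%:R * (beta - r) / beta) ->
  exists2 x : nat -> R,
    x @ \oo --> beta ^+ k / (k`!)%:R * period_mass k q s &
    \forall n \near \oo, B n <= x n * n%:R ^+ k.
Proof.
move=> sE; have Q2 : 2 <= q%:R :> R by rewrite ler_nat.
have [qb2 qb1] := q_beta.
have br0 : 0 < beta - r by rewrite subr_gt0.
pose over n := (q.+1 * (b n).+1 - n.+1)%N.
have over_lim : scales 1 over (beta - r).
  have h := scalesB (scalesMl (c := q.+1) T_beta) S_1.
  have e : q.+1%:R * beta - 1 = beta - r by rewrite -natr1; move: beta_r; lra.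
  by rewrite e (max_idPr (ltW br0)) in h.
pose g n := minn ((b n).+1 %/ q) (over n).
have g_lim : scales 1 g (Num.min (beta / q%:R) (beta - r)).
  apply: scales_min over_lim; rewrite ?(ltW br0) // ?divr_ge0 ?ler0n ?ltW //.
  by apply: scales_divn T_beta; lia.
pose sn n : R := (q * g n)%:R / (b n).+1%:R.
have sn_lim : sn @ \oo --> s.
  have h : (fun n => ((b n).+1%:R / n%:R ^+ 1)^-1) @ \oo --> beta^-1.
    by apply: cvgV T_beta; rewrite gt_eqF.
  have -> : s = q%:R * Num.min (beta / q%:R) (beta - r) / beta.
    rewrite sE minr_pMr ?ler0n // minr_pMl ?invr_ge0 ?ltW //.
    by rewrite mulrCA divff ?mulr1 ?divff ?gt_eqF //; lra.
  apply: cvg_near_eq (seq_cvgM (scalesMl (c := q) g_lim) h); near=> n.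
  have n0 : n%:R != 0 :> R.
    by rewrite pnatr_eq0 -lt0n; near: n; apply: nbhs_infty_gt.
  by rewrite expr1 invf_div mulrA divfK.
exists (fun n => (((b n).+1%:R / n%:R ^+ 1) ^+ k) / (k`!)%:R *
   period_mass k q (sn n) + (n%:R^-1) ^+ k).
  rewrite -[X in _ --> X]addr0; apply: seq_cvgD.
    apply: seq_cvgM (cvg_period_mass sn_lim).
    by apply: seq_cvgM (seq_cvg_cst _); apply: cvg_pow.
  have := cvg_pow (k := k) (@cvg_inv_nat R).
  by rewrite expr0n (gtn_eqF k_gt0).
near=> n.
have n0 : n%:R != 0 :> R.
  by rewrite pnatr_eq0 -lt0n; near: n; apply: nbhs_infty_gt.
rewrite mulrDl -exprMn mulVf // expr1n expr1 expr_div_n.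
have -> : (b n).+1%:R ^+ k / n%:R ^+ k / (k`!)%:R * period_mass k q (sn n) *
    n%:R ^+ k = (b n).+1%:R ^+ k / (k`!)%:R * period_mass k q (sn n).
  have N0 : n%:R ^+ k != 0 :> R by rewrite expf_neq0.
  have f0 : (k`!)%:R != 0 :> R by rewrite pnatr_eq0 -lt0n fact_gt0.
  move: (n%:R ^+ k) N0 ((b n).+1%:R ^+ k) (k`!%:R) f0 => N N0 T f f0.
  by field; rewrite N0 f0.
apply: bandwidth_upper => //.
  apply: leq_trans (leq_trunc_div (b n).+1 q); rewrite mulnC leq_mul2r.
  by rewrite geq_minl orbT.
have lt : (n.+1 < q.+1 * (b n).+1)%N.
  near: n; apply: scales_lt S_1 (scalesMl (c := q.+1) T_beta) _.
  by rewrite -natr1; move: beta_r r_lt; lra.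
have : (g n <= over n)%N by rewrite geq_minr.
by rewrite /over; lia.
Unshelve. all: by end_near. Qed.

End Bandwidth.
End Asymptotics.

Lemma scales_of_asymp (R : realType) (u : nat -> nat) (l : R) :
  (fun n => (u n)%:R : R) ~_\oo (fun n => l * n%:R) -> scales 1 u l.
Proof.
move=> /asymp_eqP[e e0 ul].
have h := seq_cvgM (seq_cvgD (seq_cvg_cst 1) e0) (seq_cvg_cst l).
rewrite addr0 mul1r in h; apply: cvg_near_eq h; near=> n.
have -> : (u n)%:R = (1 + e n) * (l * n%:R) by near: n.
rewrite expr1 mulrA mulfK // pnatr_eq0 -lt0n.
by near: n; apply: nbhs_infty_gt.
Unshelve. all: by end_near. Qed.

(** The threshold on [r] compares the overlap of [q + 1] windows with the
    [q]-th part of a window. *)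
Lemma threshold_le (R : realType) (q : nat) (beta r : R) : (1 < q)%N ->
  1 = q%:R * beta + r ->
  (r <= (q%:R - 1) / (q%:R ^+ 2 + q%:R - 1)) = (beta <= q%:R * (beta - r)).
Proof.
rewrite -(ltr1n R); move: (q%:R) => Q Q1 e.
rewrite ler_pdivlMr; last by rewrite expr2; nra.
rewrite -subr_ge0 -[RHS]subr_ge0 -[RHS](pmulr_rge0 _ (lt_trans ltr01 Q1)).
congr (0 <= _); rewrite -[Q - 1]mul1r [X in X * (Q - 1)]e; ring.
Qed.

Theorem theorem2 (R : realType) (k : nat) (beta : R) (b : nat -> nat)
    (q : nat) (r : R) :
  (2 <= k)%N ->
  0 < beta <= 1 / 2 ->
  (fun n : nat => (b n)%:R : R) ~_\oo (fun n : nat => beta * n%:R) ->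
  1 = q%:R * beta + r ->
  (2 <= q)%N ->
  0 <= r < beta ->
  (r <= (q%:R - 1) / (q%:R ^+ 2 + q%:R - 1) ->
     (fun n : nat => (bandwidth_G n k (b n))%:R : R)
       ~_\oo (fun n : nat => c1 beta k q * n%:R ^+ k))
  /\
  ((q%:R - 1) / (q%:R ^+ 2 + q%:R - 1) < r ->
     asymp_le
       (fun n : nat =>
          Num.max (c1 beta k q)
                  (c2 beta k q + 1 / q%:R ^+ (k - 1) * c3 beta k q r)
          * n%:R ^+ k)
       (fun n : nat => (bandwidth_G n k (b n))%:R)
     /\
     asymp_le
       (fun n : nat => (bandwidth_G n k (b n))%:R)
       (fun n : nat => (c2 beta k q + c3 beta k q r) * n%:R ^+ k)).
Proof.
move=> k2 /andP[beta0 beta_half] b_asymp e q2 /andP[r0 r_lt].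
have k0 : (0 < k)%N by apply: ltnW.
have q0 : (0 < q)%N by apply: ltnW.
have b_lim := scales_of_asymp b_asymp.
have pow_gt0 : \forall n \near \oo, 0 < n%:R ^+ k :> R.
  near=> n; rewrite exprn_gt0 // ltr0n.
  by near: n; apply: nbhs_infty_gt.
have pow_ge0 n : 0 <= n%:R ^+ k :> R by rewrite exprn_ge0.
have [x1 x1_lim x1_le] := clique_chain_bound k0 q2 beta0 r0 r_lt e b_lim.
have [x2 x2_lim x2_le] := overlap_bound k0 q2 beta0 r0 r_lt e b_lim.
have [y y_lim le_y] := profile_bound k0 q2 beta0 r0 r_lt e b_lim erefl.
have c1_pos : 0 < c1 beta k q by apply: c1_gt0.
rewrite ltNge (threshold_le q2 e); split=> [le_r|].
  rewrite (min_idPl _) ?ler_pdivlMr ?mul1r // c1_period_mass // in y_lim.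
  exact: asymp_eq_squeeze x1_lim y_lim pow_gt0 x1_le le_y.
rewrite -ltNge => lt_r.
rewrite (min_idPr _) in y_lim; last by rewrite ler_pdivrMr // mul1r ltW.
rewrite c2_c3_period_mass ?gt_eqF // in y_lim.
split; last first.
  apply: asymp_le_upper y_lim le_y; apply: c2_c3_gt0 => //; last exact: ltW.
  by apply: le_trans beta_half _; lra.
case: (leP (c1 beta k q) _) => [le_c|lt_c].
  exact: asymp_le_lower (lt_le_trans c1_pos le_c) x2_lim pow_ge0 x2_le.
exact: asymp_le_lower c1_pos x1_lim pow_ge0 x1_le.
Unshelve. all: by end_near. Qed.
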